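(* Let $k\ge 2$ and let $B_k$ be the binomial tree with $2^{k-1}$ vertices. Then $cfc(B_k)=k-1$.
   Context: The rooted binomial tree $B_k$ is defined recursively: $B_1$ is a single vertex (its root); for $k>1$, $B_k$ consists of two disjoint copies of $B_{k-1}$ together with an edge joining their roots, the root of $B_k$ being the root of the first copy. For an edge-colored graph, a path is conflict-free if some color occurs on exactly one of its edges; $cfc(G)$ is the minimum number of colors in an edge-coloring of the connected graph $G$ in which every pair of distinct vertices is joined by a conflict-free path. *)

(* Defs.v *)
From mathcomp Require Import all_boot.

Set Implicit Arguments.
Unset Strict Implicit.
Unset Printing Implicit Defensive.

Record sgraph := SGraph {
  vertex :> finType;
  adj : rel vertex;
  adj_sym : symmetric adj;
  adj_irr : irreflexive adj }.

Definition edges (G : sgraph) : {set {set G}} :=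
  [set e : {set G} | [exists x, exists y, adj x y && (e == [set x; y])]].

Record rgraph := RGraph { rg_graph :> sgraph; root : rg_graph }.

Definition single_rel : rel unit := fun _ _ => false.

Fact single_sym : symmetric single_rel. Proof. by []. Qed.
Fact single_irr : irreflexive single_rel. Proof. by []. Qed.

Definition single : rgraph := @RGraph (SGraph single_sym single_irr) tt.

Section Join.
Variables G H : rgraph.

Definition join_rel : rel (G + H)%type := fun u v =>
  match u, v with
  | inl x, inl y => adj x y
  | inr x, inr y => adj x y
  | inl x, inr y => (x == root G) && (y == root H)
  | inr x, inl y => (x == root H) && (y == root G)
  end.

Fact join_sym : symmetric join_rel.
Proof. by move=> [x|x] [y|y] //=; rewrite 1?adj_sym 1?andbC. Qed.

Fact join_irr : irreflexive join_rel.
Proof. by move=> [x|x] /=; rewrite adj_irr. Qed.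

Definition join : rgraph :=
  @RGraph (@SGraph (G + H)%type _ join_sym join_irr) (inl (root G)).

End Join.

(* The value at k = 0 is junk: the trees B_k start at k = 1. *)
Fixpoint binomial_tree (k : nat) : rgraph :=
  match k with
  | 0 | 1 => single
  | k'.+1 => join (binomial_tree k') (binomial_tree k')
  end.

Lemma card_binomial_tree (k : nat) : #|binomial_tree k| = 2 ^ k.-1.
Proof.
elim: k => [|[|k] IHk]; rewrite ?card_unit //.
by rewrite [LHS]card_sum IHk addnn -mul2n -expnS.
Qed.

Section ConflictFree.
Variable G : sgraph.

(* The path visits x, then the vertices of p, all distinct. *)
Definition is_path (x y : G) (p : seq G) : Prop :=
  [/\ path (@adj G) x p, uniq (x :: p) & last x p = y].

Definition path_edges (x : G) (p : seq G) : seq {set G} :=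
  pairmap (fun u v => [set u; v]) x p.

Definition conflict_free (c : {set G} -> nat) (x : G) (p : seq G) : Prop :=
  exists a : nat, count (fun e => c e == a) (path_edges x p) = 1.

(* Only the values of c on edges G matter; the m colors are 0, ..., m - 1, and
   the coloring need not be proper. *)
Definition cf_colorable (m : nat) : Prop :=
  exists c : {set G} -> nat,
    (forall e, e \in edges G -> c e < m) /\
    (forall x y : G, x != y ->
       exists p : seq G, is_path x y p /\ conflict_free c x p).

(* is_cfc m means that cfc(G) is defined and equal to m; cf_colorable forces G
   to be connected, so no m satisfies it when G is disconnected. *)
Definition is_cfc (m : nat) : Prop :=
  cf_colorable m /\ (forall m' : nat, cf_colorable m' -> m <= m').

End ConflictFree.

(* Main.v *)
Require Import Defs.
From mathcomp Require Import all_boot.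

Set Implicit Arguments.
Unset Strict Implicit.
Unset Printing Implicit Defensive.

(** In a forest, the only path between two neighbors of a vertex v is the one of
    length two through v. It is conflict-free only if its two edges have
    different colors, so the number of colors is at least the degree of v. The
    root of B_k has degree k - 1. Conversely, a conflict-free coloring with m
    colors of two graphs extends to their join by giving the new edge a new
    color: a path between the two sides uses that edge exactly once. *)

(** A cycle is an edge together with a second path between its ends; this form needs no notion of
    cycle. *)
Definition acyclic (G : sgraph) : Prop :=
  forall (x y : G) (p : seq G), adj x y -> is_path x y p -> p = [:: y].

Definition neighbors (G : sgraph) (x : G) : {set G} := [set y | adj x y].

(** * Edges, and the degree bound in acyclic graphs *)

Lemma adj_neq (G : sgraph) (x y : G) : adj x y -> x != y.
Proof. by move=> xy; apply/eqP=> eq_xy; rewrite eq_xy adj_irr in xy. Qed.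

Lemma mem_edges (G : sgraph) (x y : G) : adj x y -> [set x; y] \in edges G.
Proof.
by move=> xy; rewrite inE; apply/existsP; exists x; apply/existsP; exists y;
  rewrite xy eqxx.
Qed.

Lemma path_edgesP {G : sgraph} {x : G} {p : seq G} {e : {set G}} :
  path (@adj G) x p -> e \in path_edges x p ->
  exists u v : G, adj u v /\ e = [set u; v].
Proof.
elim: p x => //= y p IHp x /andP[xy yp]; rewrite inE => /orP[/eqP->|].
  by exists x, y.
exact: IHp.
Qed.

(** If the path misses [r], putting [r] in front gives a second path from [r] to its neighbor [v].
    Otherwise it splits at [r] into two paths between adjacent vertices, each a single edge. *)
Lemma acyclic_path_between_neighbors (G : sgraph) (r u v : G) (p : seq G) :
  acyclic G -> adj r u -> adj r v -> u != v -> is_path u v p -> p = [:: r; v].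
Proof.
move=> acG ru rv uv [up uniq_p last_p].
have [r_p|r_p] := boolP (r \in p); last first.
  have : u :: p = [:: v].
    apply: acG rv _; split=> //=; first by rewrite ru.
    by rewrite inE negb_or (adj_neq ru) r_p.
  by case=> eq_uv; rewrite eq_uv eqxx in uv.
case/splitPr: r_p up uniq_p last_p => p1 p2.
rewrite -cat_cons cat_uniq cat_path last_cat.
move=> /and3P[up1 p1r rp2] /and3P[uniq1 disj uniq2] /= last_p.
have p1E : rcons p1 r = [:: r].
  apply: (acG u r); first by rewrite adj_sym.
  split; rewrite ?rcons_path ?up1 ?last_rcons //.
  by rewrite -rcons_cons rcons_uniq uniq1 andbT; case/norP: disj.
have p2E : p2 = [:: v] by apply: acG rv _; split.
by case: p1 p1E {up1 p1r uniq1 disj} => [|z [|? ?]] // _; rewrite p2E.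
Qed.

Lemma card_neighbors_le (G : sgraph) (m : nat) (r : G) :
  acyclic G -> cf_colorable G m -> #|neighbors r| <= m.
Proof.
move=> acG [c [c_lt c_cf]].
pose f y := c [set r; y].
have f_lt y : y \in neighbors r -> f y < m.
  by rewrite inE => ry; apply/c_lt/mem_edges.
have f_inj : {in neighbors r &, injective f}.
  move=> u v; rewrite !inE => ru rv fuv; apply/eqP/negPn/negP=> uv.
  have [p [path_p [a]]] := c_cf _ _ uv.
  rewrite (acyclic_path_between_neighbors acG ru rv uv path_p) /=.
  (* With equal colors on the two edges, every color occurs 0 or 2 times. *)
  by rewrite setUC -/(f u) -/(f v) fuv; case: (f v == a).
rewrite cardE -(size_map f) -(size_iota 0 m); apply: uniq_leq_size.
  by rewrite map_inj_in_uniq ?enum_uniq // => u v; rewrite !mem_enum; exact: f_inj.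
by move=> a /mapP[y]; rewrite mem_enum mem_iota => /f_lt lt_y ->.
Qed.

(** * Colors along paths, their images and their reversals *)

Lemma cf_colorable_connected (G : sgraph) (m : nat) (x y : G) :
  cf_colorable G m -> exists p : seq G, is_path x y p.
Proof.
move=> [c [_ c_cf]]; have [->|/c_cf[p []]] := eqVneq x y; last by exists p.
by exists [::].
Qed.

Lemma count_fresh_color (G : sgraph) (c : {set G} -> nat) (m : nat) (x : G) p :
  (forall e, e \in edges G -> c e < m) -> path (@adj G) x p ->
  count (fun e => c e == m) (path_edges x p) = 0.
Proof.
move=> c_lt xp; apply/eqP; rewrite -leqn0 leqNgt -has_count; apply/hasPn => e.
by case/(path_edgesP xp)=> u [v [uv ->]]; rewrite ltn_eqF ?c_lt ?mem_edges.
Qed.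

Lemma path_edges_map (G1 G2 : sgraph) (f : G1 -> G2) (x : G1) (p : seq G1) :
  path_edges (f x) (map f p) = [seq f @: e | e : {set G1} <- path_edges x p].
Proof. by elim: p x => //= y p IHp x; rewrite imsetU1 imset_set1 -IHp. Qed.

Lemma count_path_edges_map (G1 G2 : sgraph) (f : G1 -> G2)
    (c1 : {set G1} -> nat) (c2 : {set G2} -> nat) (a : nat) (x : G1) p :
  (forall u v, c2 (f @: [set u; v]) = c1 [set u; v]) -> path (@adj G1) x p ->
  count (fun e => c2 e == a) (path_edges (f x) (map f p)) =
  count (fun e => c1 e == a) (path_edges x p).
Proof.
move=> cE xp; rewrite path_edges_map count_map.
by apply: eq_in_count => e /(path_edgesP xp)[u [v [_ ->]]] /=; rewrite cE.
Qed.

(** The list of a path omits its first vertex, so the reversed list must drop [y] and gain [x];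
    [belast] does both. *)
Lemma is_path_rev (G : sgraph) (x y : G) (p : seq G) :
  is_path x y p -> is_path y x (rev (belast x p)).
Proof.
move=> [xp uniq_p <-]; split.
- by rewrite rev_path (eq_path (e' := @adj G)) // => u v; rewrite /= adj_sym.
- by rewrite -rev_rcons -lastI rev_uniq.
- by case: p {xp uniq_p} => //= z p; rewrite rev_cons last_rcons.
Qed.

Lemma path_edges_rev (G : sgraph) (x : G) (p : seq G) :
  path_edges (last x p) (rev (belast x p)) = rev (path_edges x p).
Proof.
elim: p x => //= y p IHp x; rewrite !rev_cons -IHp /path_edges -cats1.
rewrite pairmap_cat /= cats1 setUC.
by case: p {IHp} => //= z p; rewrite rev_cons last_rcons.
Qed.

Lemma conflict_free_rev (G : sgraph) (c : {set G} -> nat) (x y : G) :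
  (exists p, is_path x y p /\ conflict_free c x p) ->
  exists p, is_path y x p /\ conflict_free c y p.
Proof.
move=> [p [path_p [a count_p]]]; exists (rev (belast x p)).
split; first exact: is_path_rev.
have [_ _ <-] := path_p; exists a.
by rewrite path_edges_rev count_rev.
Qed.

(** * Paths and colorings of a join *)

Section Join.
Variables G H : Defs.rgraph.
Implicit Types (u v : join G H) (p : seq (join G H)).

Let side u : bool := if u is inl _ then true else false.
(** The ends of the joining edge; the boolean index lets both sides be treated at once. *)
Let tip (b : bool) : join G H := if b then inl (Defs.root G) else inr (Defs.root H).

Lemma join_adj_cross u v :
  adj u v -> side u != side v -> u = tip (side u) /\ v = tip (side v).
Proof. by case: u v => [x|x] [y|y] //= /andP[/eqP-> /eqP->]. Qed.

(** A change of side runs along the joining edge and so visits both tips; missing either one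
    confines the path to one side. *)
Lemma join_path_avoiding_tip b u p :
  path (@adj (join G H)) u p -> tip b \notin u :: p ->
  all (fun v => side v == side u) p.
Proof.
elim: p u => // v p IHp u; rewrite /= inE => /andP[uv vp] /norP[tip_u tip_p].
have [suv|/eqP suv] := eqVneq (side v) (side u); first by rewrite -suv IHp.
have [uE vE] : u = tip (side u) /\ v = tip (side v).
  by apply: join_adj_cross => //; apply/eqP => /esym.
case/negP: tip_u; rewrite uE; apply/eqP; congr tip.
have tip_v : b != side v.
  by apply: contraNneq tip_p => ->; rewrite -vE mem_head.
by move: suv tip_v; case: b (side u) (side v) {IHp tip_p} => [] [] [].
Qed.

(** A path that leaves its side has used up the tip there, so it cannot return and would end on the
    other side. *)
Lemma join_path_same_side u p :
  path (@adj (join G H)) u p -> uniq (u :: p) -> side (last u p) = side u ->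
  all (fun v => side v == side u) p.
Proof.
elim: p u => // v p IHp u /= /andP[uv vp] /andP[u_p uniq_p] last_p.
have [suv|suv] := eqVneq (side v) (side u).
  by rewrite -suv; apply: IHp; rewrite ?suv.
have [uE _] : u = tip (side u) /\ v = tip (side v).
  by apply: join_adj_cross; rewrite // eq_sym.
rewrite uE in u_p; have /allP/= same := join_path_avoiding_tip vp u_p.
have := mem_last v p; rewrite inE => /predU1P[lastE|/same].
  by rewrite -last_p lastE eqxx in suv.
by rewrite last_p eq_sym (negPf suv).
Qed.

Lemma map_inlP p : all side p -> exists q : seq G, p = map inl q.
Proof.
elim: p => [|[x|y] p IHp] //= => [_|/IHp[q ->]]; first by exists [::].
by exists (x :: q).
Qed.

Lemma map_inrP p : all (fun u => ~~ side u) p -> exists q : seq H, p = map inr q.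
Proof.
elim: p => [|[x|y] p IHp] //= => [_|/IHp[q ->]]; first by exists [::].
by exists (y :: q).
Qed.

Lemma is_path_inl (x y : G) (q : seq G) :
  @is_path (join G H) (inl x) (inl y) (map inl q) <-> is_path x y q.
Proof.
rewrite /is_path path_map -map_cons (map_inj_uniq (@inl_inj _ _)) last_map.
by split=> [[? ? [?]]|[? ? <-]].
Qed.

Lemma is_path_inr (x y : H) (q : seq H) :
  @is_path (join G H) (inr x) (inr y) (map inr q) <-> is_path x y q.
Proof.
rewrite /is_path path_map -map_cons (map_inj_uniq (@inr_inj _ _)) last_map.
by split=> [[? ? [?]]|[? ? <-]].
Qed.

Lemma acyclic_join : acyclic G -> acyclic H -> acyclic (join G H).
Proof.
move=> acG acH u v p uv path_p; have [up uniq_p last_p] := path_p.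
have [suv|suv] := eqVneq (side u) (side v).
  have := join_path_same_side up uniq_p; rewrite last_p => /(_ (esym suv)).
  case: u v uv suv path_p {up uniq_p last_p} => [x|x] [y|y] // xy _ path_p same.
    have [|q pE] := @map_inlP p.
      by apply: sub_all same => w /eqP->.
    by move: path_p; rewrite pE => /is_path_inl/(acG _ _ _ xy)->.
  have [|q pE] := @map_inrP p.
    by apply: sub_all same => w /eqP->.
  by move: path_p; rewrite pE => /is_path_inr/(acH _ _ _ xy)->.
(* The remaining case: [u] and [v] are the ends of the joining edge. *)
have [uE vE] := join_adj_cross uv suv.
case: p up uniq_p last_p {path_p} => [|w p] /=.
  by move=> _ _ eq_uv; rewrite eq_uv eqxx in suv.
move=> /andP[uw wp] /and3P[u_p w_p _] last_p.
(* If the first step stays on the side of [u], the path can no longer cross, since [u] was the only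
   exit. *)
have [suw|suw] := eqVneq (side u) (side w).
  rewrite uE in u_p; have /allP/= same := join_path_avoiding_tip wp u_p.
  have := mem_last w p; rewrite last_p inE => /predU1P[vw|/same].
    by rewrite suw vw eqxx in suv.
  by rewrite -suw eq_sym (negPf suv).
have [_ wE] := join_adj_cross uw suw.
have eq_vw : v = w.
  by rewrite vE wE; congr tip; move: suv suw; case: (side u) (side v) (side w) => [] [] [].
(* The first step already reaches [v]; a longer path would visit [v] again at its end. *)
have := mem_last w p; rewrite last_p eq_vw inE.
case: p w_p last_p {u_p wp} => //= z p w_p last_p.
by have := mem_last z p; rewrite last_p eq_vw (negPf w_p).
Qed.

Lemma card_neighbors_join :
  #|neighbors (Defs.root (join G H))| = #|neighbors (Defs.root G)|.+1.
Proof.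
have -> : neighbors (Defs.root (join G H)) =
    inr (Defs.root H) |: [set inl x | x in neighbors (Defs.root G)].
  apply/setP=> -[x|y]; rewrite !inE /= ?(mem_imset _ _ (@inl_inj _ _)) ?inE //.
  rewrite eqxx /=; apply/eqP/orP => [->|[/eqP[->]//|/imsetP[]//]].
  by left.
rewrite cardsU1 (card_imset _ (@inl_inj _ _)).
by case: imsetP => // -[].
Qed.

Lemma cf_colorable_join m :
  cf_colorable G m -> cf_colorable H m -> cf_colorable (join G H) m.+1.
Proof.
move=> colG colH; have [[cG [cG_lt cG_cf]] [cH [cH_lt cH_cf]]] := (colG, colH).
(* A coloring is defined on all vertex sets, so [c] inspects the traces of [e] on the two sides.
   Among edges, only the joining one meets both. *)
pose c (e : {set join G H}) :=
  let eG := inl @^-1: e in let eH := inr @^-1: e in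
  if eH == set0 then cG eG else if eG == set0 then cH eH else m.
have cE1 (x y : G) : c (inl @: [set x; y]) = cG [set x; y].
  rewrite /c; set e := [set x; y].
  have -> : inr @^-1: (inl @: e : {set join G H}) = set0.
    by apply/setP=> z; rewrite !inE; apply/imsetP=> -[].
  rewrite eqxx; congr cG.
  by apply/setP=> z; rewrite inE (mem_imset _ _ (@inl_inj _ _)).
have cE2 (x y : H) : c (inr @: [set x; y]) = cH [set x; y].
  rewrite /c; set e := [set x; y].
  have -> : inl @^-1: (inr @: e : {set join G H}) = set0.
    by apply/setP=> z; rewrite !inE; apply/imsetP=> -[].
  have -> : inr @^-1: (inr @: e : {set join G H}) = e.
    by apply/setP=> z; rewrite inE (mem_imset _ _ (@inr_inj _ _)).
  (* An edge is nonempty, so the first test in [c] fails. *)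
  rewrite eqxx; case: eqP => // e0.
  by have := set21 x y; rewrite -/e e0 inE.
have cE3 (x : G) (y : H) : c [set inl x; inr y] = m.
  rewrite /c; case: eqP => [/setP/(_ y)|_]; first by rewrite !inE eqxx orbT.
  by case: eqP => // /setP/(_ x); rewrite !inE eqxx.
have cross (x : G) (y : H) : exists p,
    @is_path (join G H) (inl x) (inr y) p /\ conflict_free c (inl x) p.
  (* Any paths to and from the roots will do, conflict-free or not: their colors are below [m], so
     [m] occurs only on the joining edge. *)
  have [p1 path1] := cf_colorable_connected x (Defs.root G) colG.
  have [p2 path2] := cf_colorable_connected (Defs.root H) y colH.
  have [xp1 uniq1 last1] := (is_path_inl _ _ _).2 path1.
  have [xp2 uniq2 last2] := (is_path_inr _ _ _).2 path2.
  exists (map inl p1 ++ inr (Defs.root H) :: map inr p2); split; last exists m.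
    split.
    - by rewrite cat_path xp1 last1 /= !eqxx.
    - rewrite -cat_cons cat_uniq uniq1 uniq2 andbT -!map_cons.
      by apply/hasPn=> _ /mapP[z _ ->]; apply/mapP=> -[].
    - by rewrite last_cat.
  rewrite /path_edges pairmap_cat count_cat /= last1 cE3 eqxx.
  have [[xq1 _ _] [xq2 _ _]] := (path1, path2).
  rewrite (@count_path_edges_map G (join G H) inl cG c m _ _ cE1 xq1).
  rewrite (@count_path_edges_map H (join G H) inr cH c m _ _ cE2 xq2).
  by rewrite (count_fresh_color cG_lt xq1) (count_fresh_color cH_lt xq2).
exists c; split=> [e|].
  rewrite inE => /existsP[u /existsP[v /andP[uv /eqP->]]].
  case: u v uv => [x|x] [y|y] /= uv.
  - have := cE1 x y; rewrite imsetU1 imset_set1 => ->.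
    by rewrite ltnW // ltnS cG_lt ?mem_edges.
  - by rewrite cE3.
  - by rewrite setUC cE3.
  - have := cE2 x y; rewrite imsetU1 imset_set1 => ->.
    by rewrite ltnW // ltnS cH_lt ?mem_edges.
move=> [x|x] [y|y] xy.
- have [p [path_p [a count_p]]] := cG_cf x y xy.
  exists (map inl p); split; first exact/is_path_inl.
  exists a; have [xp _ _] := path_p.
  by rewrite (@count_path_edges_map G (join G H) inl cG c a _ _ cE1 xp).
- exact: cross.
- exact/conflict_free_rev/cross.
- have [p [path_p [a count_p]]] := cH_cf x y xy.
  exists (map inr p); split; first exact/is_path_inr.
  exists a; have [xp _ _] := path_p.
  by rewrite (@count_path_edges_map H (join G H) inr cH c a _ _ cE2 xp).
Qed.

End Join.

(** * Induction over the binomial trees *)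

Lemma binomial_tree_join (k : nat) :
  binomial_tree k.+2 = join (binomial_tree k.+1) (binomial_tree k.+1).
Proof. by []. Qed.

Lemma acyclic_binomial_tree (k : nat) : acyclic (binomial_tree k).
Proof.
elim: k => [|[|k] IHk] //; rewrite binomial_tree_join; exact: acyclic_join.
Qed.

Lemma card_neighbors_binomial_tree (k : nat) :
  #|neighbors (Defs.root (binomial_tree k.+1))| = k.
Proof.
elim: k => [|k IHk]; last by rewrite binomial_tree_join card_neighbors_join IHk.
by apply: eq_card0 => x; rewrite inE.
Qed.

Lemma cf_colorable_binomial_tree (k : nat) : cf_colorable (binomial_tree k.+1) k.
Proof.
elim: k => [|k IHk]; last by rewrite binomial_tree_join; exact: cf_colorable_join.
(* A single vertex needs zero colors: it has no edge to color and no pair of distinct vertices. *)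
exists (fun=> 0); split=> [e|[] []//].
by rewrite inE => /existsP[x /existsP[y]].
Qed.

Theorem theorem3p5 (k : nat) (hk : 2 <= k) : is_cfc (binomial_tree k) (k - 1).
Proof.
case: k hk => // k _; rewrite subn1 /=.
split=> [|m col_m]; first exact: cf_colorable_binomial_tree.
(* The bound is read as the degree of the root. *)
rewrite -(card_neighbors_binomial_tree k).
exact: card_neighbors_le (@acyclic_binomial_tree k.+1) col_m.
Qed.
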